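(* Let $k$ be a field, let $n\geq 1$, and let $Q$ be the linearly oriented quiver of type $A_n$, i.e. the quiver with vertices $1,\dots,n$ and arrows $i+1\to i$ for $1\leq i\leq n-1$ (unique sink $1$, unique source $n$). Then a maximum antichain of the poset $(\mathcal{P}_Q,\leq)$ consists of exactly $n$ elements.
   Context: A representation $V$ of a quiver $Q$ over $k$ assigns a finite-dimensional $k$-vector space $V_i$ to every vertex $i$ and a $k$-linear map $V_\alpha\colon V_i\to V_j$ to every arrow $\alpha\colon i\to j$. A morphism $\phi\colon V\to W$ is a family of linear maps $\phi_i\colon V_i\to W_i$ with $W_\alpha\circ\phi_i=\phi_j\circ V_\alpha$ for every arrow $\alpha\colon i\to j$; it is a monomorphism if every $\phi_i$ is injective. For a quiver $Q$ whose underlying graph is the path $1-2-\cdots-n$ and for $1\leq a\leq b\leq n$, let $[a,b]$ denote the representation with $V_i=k$ for $a\leq i\leq b$ and $V_i=0$ otherwise, with $V_\alpha=\mathrm{id}_k$ for every arrow $\alpha$ between vertices in $\{a,\dots,b\}$ and $V_\alpha=0$ for all other arrows. (These represent all isomorphism classes of indecomposable representations of $Q$.) Let $\mathcal{P}_Q=\{[a,b]\colon 1\leq a\leq b\leq n\}$, ordered by $[a,b]\leq[a',b']$ if and only if there exists a monomorphism $[a,b]\hookrightarrow[a',b']$. An antichain in a poset is a subset of pairwise incomparable elements; it is maximum if no antichain has larger cardinality. *)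

(* Defs.v *)
From mathcomp Require Import all_boot all_algebra.

Set Implicit Arguments.
Unset Strict Implicit.
Unset Printing Implicit Defensive.

Import GRing.Theory.
Local Open Scope ring_scope.

Record quiver (I : finType) := Quiver {
  arrow : finType;
  source : arrow -> I;
  target : arrow -> I
}.

Record representation (k : fieldType) (I : finType) (Q : quiver I) :=
  Representation {
    rep_space : I -> vectType k;
    rep_map : forall al : arrow Q,
      'Hom(rep_space (source al), rep_space (target al))
  }.

Record rep_morphism (k : fieldType) (I : finType) (Q : quiver I)
    (V W : representation k Q) := RepMorphism {
  mor_map : forall i : I, 'Hom(rep_space V i, rep_space W i);
  mor_commutes : forall al : arrow Q,
    (rep_map W al \o mor_map (source al))%VF =
    (mor_map (target al) \o rep_map V al)%VF
}.

Definition monomorphism (k : fieldType) (I : finType) (Q : quiver I)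
    (V W : representation k Q) (phi : rep_morphism V W) : Prop :=
  forall i : I, injective (mor_map phi i).

(* Vertices 1, ..., n are encoded as 0, ..., n-1; the arrows are the pairs
   (i+1, i), with source i+1 and target i. *)
Definition linear_quiver (n : nat) : quiver 'I_n :=
  @Quiver 'I_n {p : 'I_n * 'I_n | val p.1 == (val p.2).+1}
    (fun al => (val al).1) (fun al => (val al).2).

Definition interval_space (k : fieldType) (s : bool) : vectType k :=
  if s then (k^o : vectType k) else ('rV[k]_0 : vectType k).

Definition interval_map (k : fieldType) (s t : bool) :
    'Hom(interval_space k s, interval_space k t) :=
  match s, t with
  | true, true => (\1%VF : 'End(k^o))
  | _, _ => 0
  end.

(* The pairs a <= b of vertices, indexing the representations [a, b]. *)
Definition vertex_interval (n : nat) : finType :=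
  {p : 'I_n * 'I_n | (val p.1 <= val p.2)%N}.

Definition in_interval (n : nat) (p : vertex_interval n) (i : 'I_n) : bool :=
  ((val p).1 <= i <= (val p).2)%N.

Definition interval_rep (k : fieldType) (n : nat) (Q : quiver 'I_n)
    (p : vertex_interval n) : representation k Q :=
  @Representation k 'I_n Q
    (fun i => interval_space k (in_interval p i))
    (fun al => interval_map k (in_interval p (source al))
                              (in_interval p (target al))).

Definition interval_le (k : fieldType) (n : nat) (Q : quiver 'I_n)
    (p q : vertex_interval n) : Prop :=
  exists phi : rep_morphism (interval_rep k Q p) (interval_rep k Q q),
    monomorphism phi.

Definition antichain (T : finType) (le : T -> T -> Prop) (A : {set T}) : Prop :=
  forall x y : T, x \in A -> y \in A -> x <> y -> ~ le x y /\ ~ le y x.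

Definition maximum_antichain (T : finType) (le : T -> T -> Prop)
    (A : {set T}) : Prop :=
  antichain le A /\ forall B : {set T}, antichain le B -> (#|B| <= #|A|)%N.

(* Main.v *)
Require Import Defs.
From mathcomp Require Import all_boot all_algebra.

(** Every arrow points from [i+1] to [i], so a monomorphism [[a,b] -> [a',b']]
    embeds the supports, and [a' < a] is impossible: transport along the arrow
    from [a] to [a-1] kills [[a,b]] at [a], while it is the identity of
    [[a',b']] there ([monic_square]).  Hence comparable intervals have the same
    left end ([interval_le_left]).  Conversely, of two intervals with the same
    left end the shorter one is a subrepresentation of the longer one
    ([interval_le_same_left]).

    The poset is therefore a disjoint union of [n] chains, one per left end.
    An antichain meets each chain at most once, so it has at most [n] elements
    ([card_antichain_le]), and the [n] simple representations [[i,i]] form an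
    antichain that attains this bound ([diagonal_antichain],
    [card_diagonal]). *)

Set Implicit Arguments.
Unset Strict Implicit.
Unset Printing Implicit Defensive.

Import GRing.Theory.
Local Open Scope ring_scope.

Section SingleArrow.
Variable k : fieldType.

Lemma interval_space_false_eq (x y : interval_space k false) : x = y.
Proof. by rewrite (thinmx0 (x : 'rV[k]_0)) (thinmx0 (y : 'rV[k]_0)). Qed.

Lemma interval_space_true_nonzero : exists x : interval_space k true, x <> 0.
Proof. by exists (1 : k^o); apply/eqP; exact: oner_neq0. Qed.

Lemma interval_hom_inj_sub (s t : bool)
    (f : 'Hom(interval_space k s, interval_space k t)) :
  injective f -> s -> t.
Proof.
case: s t f => [] [] // f inj_f _; have [x []] := interval_space_true_nonzero.
by apply: inj_f; exact: interval_space_false_eq.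
Qed.

(** If the target of the arrow lay outside the smaller support but inside the
    larger one, then the square would force [f = id \o f = g \o 0 = 0], which
    is not injective on a line. *)
Lemma monic_square (s s' t t' : bool)
    (f : 'Hom(interval_space k s, interval_space k s'))
    (g : 'Hom(interval_space k t, interval_space k t')) :
  injective f ->
  (interval_map k s' t' \o f)%VF = (g \o interval_map k s t)%VF ->
  s -> t' -> t.
Proof.
move=> inj_f eq_fg s_in; move: (interval_hom_inj_sub inj_f s_in) => s'_in.
case: s s' t t' s_in s'_in f g inj_f eq_fg => [] [] [] [] // _ _ f g inj_f eq_fg.
have [x []] := interval_space_true_nonzero; apply: inj_f.
have /= := congr1 (fun h : 'Hom(_, _) => h x) eq_fg.
by rewrite !comp_lfunE /= id_lfunE zero_lfunE !linear0.
Qed.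

Lemma interval_map_inj (s t : bool) : (s -> t) -> injective (interval_map k s t).
Proof.
case: s t => [] [] // st x y; first by rewrite /= !id_lfunE.
- by have := st isT.
- by move=> _; exact: interval_space_false_eq.
- by move=> _; exact: interval_space_false_eq.
Qed.

(** A composite of canonical maps is the identity of the line when the vertices
    on its path are all inside the supports, and zero otherwise.  The first
    hypothesis keeps the path through [s'] inside, the second the path through
    [t], as soon as both ends [s] and [t'] are. *)
Lemma interval_map_square (s t s' t' : bool) :
  (s -> s') -> (s -> t' -> t) ->
  (interval_map k s' t' \o interval_map k s s')%VF =
  (interval_map k t t' \o interval_map k s t)%VF.
Proof.
case: s => [ss' tt'|_ _]; last first.
  apply/lfunP=> x; rewrite (interval_space_false_eq x 0).
  by rewrite !linear0.
case: s' ss' => [_|/(_ isT)] //.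
case: t' tt' => [/(_ isT isT)|_]; first by case: t.
apply/lfunP=> x; exact: interval_space_false_eq.
Qed.

End SingleArrow.

Section IntervalOrder.
Variables (k : fieldType) (n : nat).
Local Notation le := (interval_le k (linear_quiver n)).
Local Notation rep := (interval_rep k (linear_quiver n)).
Implicit Types p q : vertex_interval n.

Lemma interval_le_left p q : le p q -> (val p).1 = (val q).1.
Proof.
case=> -[phi comm] /= mono_phi.
have a_in_p : in_interval p (val p).1 by rewrite /in_interval leqnn (valP p).
have a_in_q : in_interval q (val p).1.
  exact: interval_hom_inj_sub (mono_phi (val p).1) a_in_p.
case/andP: (a_in_q) => le_a'a le_ab'.
apply/val_inj/eqP; rewrite eqn_leq le_a'a andbT leqNgt; apply/negP=> lt_a'a.
have a_gt0 : (0 < (val p).1)%N by exact: leq_trans lt_a'a.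
(* With [a' < a] the vertex [a] is not the sink: the arrow [a -> a-1] leaves the
   support of [p] and stays inside the support of [q]. *)
have lt_pred : ((val p).1.-1 < n)%N by exact: leq_ltn_trans (leq_pred _) _.
have predK : (val p).1 = (Ordinal lt_pred).+1 :> nat by rewrite /= prednK.
pose al : arrow (linear_quiver n) :=
  exist (fun p : 'I_n * 'I_n => val p.1 == (val p.2).+1)
        ((val p).1, Ordinal lt_pred) (introT eqP predK).
have := monic_square (mono_phi (source al)) (comm al) a_in_p.
have pred_in_q : in_interval q (Ordinal lt_pred).
  by rewrite /in_interval /= (leq_trans (leq_pred _) le_ab') andbT -ltnS prednK.
move/(_ pred_in_q)/andP=> [/= + _].
by rewrite leqNgt ltn_predL a_gt0.
Qed.

Lemma interval_le_same_left p q :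
  (val p).1 = (val q).1 -> ((val p).2 <= (val q).2)%N -> le p q.
Proof.
move=> eq_a le_bb'.
have sub_pq i : in_interval p i -> in_interval q i.
  by rewrite /in_interval eq_a => /andP[-> le_ib]; exact: leq_trans le_bb'.
pose phi i := interval_map k (in_interval p i) (in_interval q i).
have comm (al : arrow (linear_quiver n)) :
      (rep_map (rep q) al \o phi (source al))%VF =
      (phi (target al) \o rep_map (rep p) al)%VF.
  apply: interval_map_square; first exact: sub_pq.
  (* The target lies one step below the source, so it can leave [p] only past
     the common left end, where it leaves [q] as well. *)
  case: al => [[i j] /= /eqP eq_ij]; rewrite /in_interval eq_a eq_ij.
  by case/andP=> _ /ltnW -> /andP[-> _].
exists (@RepMorphism _ _ _ (rep p) (rep q) phi comm) => i.
by apply: interval_map_inj; exact: sub_pq.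
Qed.

Lemma card_antichain_le (B : {set vertex_interval n}) :
  antichain le B -> (#|B| <= n)%N.
Proof.
move=> anti_B; rewrite -[leqRHS]card_ord.
have left_inj : {in B &, injective (fun p => (val p).1)}.
  move=> p q pB qB eq_a; apply/eqP/negPn/negP=> /eqP neq_pq.
  have [nle_pq nle_qp] := anti_B p q pB qB neq_pq.
  have [/(interval_le_same_left eq_a) //|/ltnW] := leqP (val p).2 (val q).2.
  by move/(interval_le_same_left (esym eq_a)).
by rewrite -(card_in_imset left_inj) max_card.
Qed.

Definition simple_interval (i : 'I_n) : vertex_interval n :=
  exist _ (i, i) (leqnn i).

Definition diagonal : {set vertex_interval n} := [set simple_interval i | i : 'I_n].

Lemma card_diagonal : #|diagonal| = n.
Proof. by rewrite card_imset ?card_ord // => i j []. Qed.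

Lemma diagonal_antichain : antichain le diagonal.
Proof.
move=> _ _ /imsetP[i _ ->] /imsetP[j _ ->] neq_ij.
by split=> /interval_le_left /= eq_ij; apply: neq_ij; rewrite eq_ij.
Qed.

End IntervalOrder.

Theorem proposition2p5 (k : fieldType) (n : nat) (hn : (1 <= n)%N) :
  (exists A : {set vertex_interval n},
     maximum_antichain (interval_le k (linear_quiver n)) A) /\
  (forall A : {set vertex_interval n},
     maximum_antichain (interval_le k (linear_quiver n)) A -> #|A| = n).
Proof.
split=> [|A [anti_A max_A]].
  exists (diagonal n); split=> [|B anti_B]; first exact: diagonal_antichain.
  by rewrite card_diagonal (card_antichain_le anti_B).
apply/eqP; rewrite eqn_leq (card_antichain_le anti_A).
by rewrite -{1}(card_diagonal n) (max_A _ (@diagonal_antichain k n)).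
Qed.
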